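(* Let $b$ be a non-constant quasi-extreme contractive multiplier of $H^2_d$, let $\alpha\in\mathbb T$, and let $\mathbf S^\alpha=(S_1^\alpha,\dots,S_d^\alpha)$ be the Clark tuple on $\mathcal H(b)$. For fixed $\zeta\in\partial\mathbb B^d$, the eigenvalue problem $$\sum_{j=1}^d\zeta_j^*S_j^\alpha h=h$$ has a nonzero solution $h\in\mathcal H(b)$ if and only if $b$ has a finite angular derivative at $\zeta$ and $b(\zeta)=\alpha$, in which case the eigenspace is one-dimensional and spanned by the function $$k^b_\zeta(z)=\frac{1-b(z)\alpha^*}{1-z\zeta^*}.$$
   Context: Fix an integer $d\ge 1$; $\mathbb B^d$ is the open unit ball of $\mathbb C^d$, $\mathbb T$ the unit circle, $\lambda^*$ denotes the complex conjugate of a scalar, and $zw^*=\sum_{j=1}^d z_jw_j^*$. $H^2_d$ (Drury–Arveson space) is the reproducing kernel Hilbert space on $\mathbb B^d$ with kernel $\frac1{1-zw^*}$. A contractive multiplier $b$ is a holomorphic function on $\mathbb B^d$ with $bf\in H^2_d$ and $\|bf\|\le\|f\|$ for all $f\in H^2_d$; $\mathcal H(b)$ is the reproducing kernel Hilbert space with kernel $k^b(z,w)=k^b_w(z)=\frac{1-b(z)b(w)^*}{1-zw^*}$. Write $(u\otimes v)h=\langle h,v\rangle u$. Quasi-extreme: $\mathbb F_d^+$ is the free semigroup of finite words in $1,\dots,d$ (including the empty word); on $\ell^2(\mathbb F_d^+)$ with orthonormal basis $\{\xi_w\}$ put $L_i\xi_w=\xi_{iw}$. For $\mathbf n\in\mathbb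 N^d$ (nonnegative integers), $|\mathbf n|=\sum n_i$, $L^{(\mathbf n)}$ is the sum of all distinct words (products) in the $L_i$ containing exactly $n_i$ factors $L_i$ for each $i$; $L^{(\mathbf 0)}=I$. $\mathcal S$ is the norm-closed linear span of all $L^{(\mathbf n)}$, $\mathcal S^*$ the set of adjoints of its elements, $\mathcal S_0=\mathrm{span}\{L^{(\mathbf n)}:|\mathbf n|\ge1\}$, $z\mathbf L^*=\sum_jz_jL_j^*$. There is a unique positive linear functional $\mu$ on $\mathcal S+\mathcal S^*$ (extended to the norm closure, which contains $q^*p$ for $p,q\in\mathcal S$) with $\frac{1+b(z)}{1-b(z)}=\mu\big((I+z\mathbf L^* )(I-z\mathbf L^* )^{-1}\big)+i\,\mathrm{Im}\big(\frac{1+b(0)}{1-b(0)}\big)$ for $z\in\mathbb B^d$. $P^2(\mu)$ is the Hilbert space obtained from $\mathcal S$ with $\langle p,q\rangle=\mu(q^*p)$ by quotienting null vectors and completing, and $P_0^2(\mu)$ is the closed span of the classes of elements of $\mathcal S_0$. $b$ is quasi-extreme if $P_0^2(\mu)=P^2(\mu)$. Clark tuple: a $d$-tuple of bounded operators $\mathbf X$ on $\mathcal H(b)$ is a contractive solution to the Gleason problem if $f(z)-f(0)=\sum_jz_j(X_jf)(z)$ for all $f\in\mathcal H(b)$ and $\sum_jX_j^*X_j\le I-k^b_0\otimes k^b_0$. For $b$ quasi-extreme it exists and is unique, and there are functions $b_1,\dots,b_d\in\mathcal H(b)$ determined by $X_jk^b_w=w_j^*k^b_w-b(w)^*b_j$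 for all $w\in\mathbb B^d$. The Clark tuple $\mathbf S^\alpha$ on $\mathcal H(b)$ is defined by $$S_j^{\alpha*}=X_j+\alpha^*(1-\alpha^*b(0))^{-1}\,b_j\otimes k^b_0$$ (it is unitarily equivalent to the GNS tuple of the AC state $\mu_\alpha$, the unique positive linear functional on $\mathcal S+\mathcal S^*$ with $\frac{1+\alpha^*b(z)}{1-\alpha^*b(z)}=\mu_\alpha\big((I+z\mathbf L^* )(I-z\mathbf L^* )^{-1}\big)+i\,\mathrm{Im}\big(\frac{1+\alpha^*b(0)}{1-\alpha^*b(0)}\big)$ for $z\in\mathbb B^d$). Angular derivative: $b$ has a finite angular derivative at $\zeta\in\partial\mathbb B^d$ if $\liminf_{z\to\zeta}\frac{1-|b(z)|^2}{1-|z|^2}<\infty$; in that case $b$ has a unimodular nontangential limit at $\zeta$, denoted $b(\zeta)$. *)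

(* Defs.v *)
From HB Require Import structures.
From mathcomp Require Import all_boot all_order all_algebra.
From mathcomp Require Import all_classical all_reals all_analysis.
From mathcomp Require Import complex ring.

Set Implicit Arguments.
Unset Strict Implicit.
Unset Printing Implicit Defensive.

Import Order.TTheory GRing.Theory Num.Theory.
Import numFieldNormedType.Exports.

Local Open Scope classical_set_scope.
Local Open Scope ring_scope.

(* R[i], declared at type numClosedFieldType so that the topology carried by
   every numFieldType is inferred on it. As usual in MathComp, `|z| and the
   order on C R are C R-valued: x <= y means that y - x is a nonnegative real. *)
Definition C (R : realType) : numClosedFieldType := R[i].

Section Operators.
Context {R : realType} {V : lmodType (C R)} (ip : V -> V -> C R).
Implicit Types T U : V -> V.

Definition bounded_op T : Prop :=
  linear T /\ exists M : C R, forall x, ip (T x) (T x) <= M * ip x x.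

Definition is_adjoint T U : Prop := forall x y, ip (T x) y = ip x (U y).

Definition positive_op T : Prop := forall x, 0 <= ip (T x) x.

Definition rank1 (u v : V) : V -> V := fun h => ip h v *: u.

(* ||T|| <= r, with both sides squared *)
Definition opnorm_le T (r : C R) : Prop :=
  forall x, ip (T x) (T x) <= r ^+ 2 * ip x x.

(* Meaningful when T has an adjoint; 0 otherwise. *)
Definition adj T : V -> V := xget 0 [set U | is_adjoint T U].

(* Meaningful when T is bijective; 0 otherwise. *)
Definition op_inv T : V -> V :=
  xget 0 [set U : V -> V | U \o T = id /\ T \o U = id].

Definition op_closure (A : set (V -> V)) : set (V -> V) :=
  [set T | bounded_op T /\
     forall e : C R, 0 < e -> exists2 U, A U & opnorm_le (T - U) e].

End Operators.

Definition linspan {R : realType} {V : lmodType (C R)} (A : set V) : set V :=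
  [set x | exists (m : nat) (c : 'I_m -> C R) (v : 'I_m -> V),
     (forall i, A (v i)) /\ x = \sum_(i < m) c i *: v i].

Record hilbert (R : realType) := Hilbert {
  hsort :> completeNormedModType (C R) ;
  hip : {dot hsort for @Num.conj (C R)} ;
  hipE : forall x : hsort, hip x x = `|x| ^+ 2 }.

(* The Hilbert space of functions on X with reproducing kernel K: the elements
   are identified with functions by the injective linear map ev. *)
Record rkhs (R : realType) (X : Type) (K : X -> X -> C R) := Rkhs {
  rk_hilbert :> hilbert R ;
  ev : rk_hilbert -> X -> C R ;
  ev_linear : forall (a : C R) (f g : rk_hilbert) x,
    ev (a *: f + g) x = a * ev f x + ev g x ;
  ev_inj : injective ev ;
  rk : X -> rk_hilbert ;
  rkE : forall z w, ev (rk w) z = K z w ;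
  ev_rk : forall f w, ev f w = hip rk_hilbert f (rk w) }.

Section Ball.
Context {R : realType} {d : nat}.
Implicit Types z w : 'rV[C R]_d.

Definition zdot z w : C R := \sum_(j < d) z 0 j * (w 0 j)^*.

Definition enorm z : C R := sqrtC (zdot z z).

Definition uball : set 'rV[C R]_d := [set z | zdot z z < 1].

Lemma uball0 : uball 0.
Proof. by rewrite /uball /= /zdot big1 ?ltr01// => j _; rewrite mxE mul0r. Qed.

End Ball.

Definition Ball (R : realType) (d : nat) := {z : 'rV[C R]_d | uball z}.
Definition ballv {R : realType} {d : nat} (z : Ball R d) : 'rV[C R]_d := sval z.
Coercion ballv : Ball >-> matrix.
Definition ball0 {R : realType} {d : nat} : Ball R d := exist _ 0 uball0.

Definition szego_kernel {R : realType} {d : nat} (z w : Ball R d) : C R :=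
  (1 - zdot z w)^-1.

Definition b_kernel {R : realType} {d : nat} (b : 'rV[C R]_d -> C R)
    (z w : Ball R d) : C R :=
  (1 - b z * (b w)^*) / (1 - zdot z w).

(* Only the values of b on the unit ball matter. *)
Definition contractive_multiplier {R : realType} {d : nat}
    (H2 : rkhs (@szego_kernel R d)) (b : 'rV[C R]_d -> C R) : Prop :=
  (forall z, uball z -> differentiable b z) /\
  (forall f : H2, exists g : H2,
     (forall z : Ball R d, ev g z = b z * ev f z) /\ `|g| <= `|f|).

Section Ell2.
Variables (R : realType) (d : nat).

Definition word := seq 'I_d.

Definition sq_summable : {pred word -> C R} :=
  [pred x | `[< exists M : C R, forall s : seq word, uniq s ->
                 \sum_(w <- s) `|x w| ^+ 2 <= M >]].

Lemma sq_summable_submod : submod_closed sq_summable.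
Proof.
split=> [|a x y /asboolP[M hM] /asboolP[N hN]]; apply/asboolP.
  by exists 0 => s _; rewrite big1// => w _; rewrite normr0 expr0n.
exists (2 * `|a| ^+ 2 * M + 2 * N) => s us.
apply: (@le_trans _ _ (\sum_(w <- s)
    (2 * `|a| ^+ 2 * `|x w| ^+ 2 + 2 * `|y w| ^+ 2))); last first.
  rewrite big_split /= -!mulr_sumr lerD//.
    by rewrite ler_wpM2l ?hM// mulr_ge0// exprn_ge0.
  by rewrite ler_wpM2l ?hN.
apply: ler_sum => w _; rewrite -mulrA -exprMn -normrM -mulrDr.
set u := a * x w; set v := y w.
have -> : (a *: x + y) w = u + v by [].
apply: (@le_trans _ _ ((`|u| + `|v|) ^+ 2)).
  by rewrite lerXn2r ?nnegrE ?addr_ge0// ler_normD.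
rewrite -subr_ge0.
have -> : 2 * (`|u| ^+ 2 + `|v| ^+ 2) - (`|u| + `|v|) ^+ 2 = (`|u| - `|v|) ^+ 2.
  by ring.
by rewrite real_exprn_even_ge0// realB.
Qed.
HB.instance Definition _ :=
  GRing.isSubmodClosed.Build _ _ sq_summable sq_summable_submod.

Record ell2 := Ell2 { ell2_fun :> word -> C R ; _ : ell2_fun \in sq_summable }.
HB.instance Definition _ := [isSub for ell2_fun].
HB.instance Definition _ := [Choice of ell2 by <:].
HB.instance Definition _ := [SubChoice_isSubLmodule of ell2 by <:].

(* <x, y> = sum_w x_w y_w^*, summed by increasing length of w (the series
   converges absolutely) *)
Definition ell2_dot (x y : ell2) : C R :=
  lim ((fun n => \sum_(k < n) \sum_(t : k.-tuple 'I_d) x t * (y t)^*) @ \oo).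

(* L_i xi_w = xi_{iw}: the coefficient of x at w moves to iw *)
Definition shift_fun (i : 'I_d) (x : word -> C R) : word -> C R :=
  fun w => if w is j :: v then (if j == i then x v else 0) else 0.

Lemma shift_fun_summable i (x : ell2) : shift_fun i x \in sq_summable.
Proof.
case: x => x /= /asboolP[M hM]; apply/asboolP; exists M => s us.
pose t := [seq behead w | w <- s & ohead w == Some i].
have ut : uniq t.
  rewrite map_inj_in_uniq ?filter_uniq// => u v.
  rewrite !mem_filter => /andP[/eqP hu _] /andP[/eqP hv _].
  by case: u v hu hv => [|a u] [|a' v] //= [->] [->] ->.
apply: le_trans (hM t ut).
rewrite /t big_map big_filter [leLHS](bigID (fun w => ohead w == Some i)) /=.
rewrite [X in _ + X]big1 ?addr0; last first.
  case=> [|j v] /= h; first by rewrite normr0 expr0n.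
  have /negPf -> : j != i by apply: contraNneq h => ->.
  by rewrite normr0 expr0n.
rewrite le_eqVlt; apply/orP; left; apply/eqP; apply: eq_bigr.
by case=> [|j v] //= /eqP[->]; rewrite eqxx.
Qed.

Definition shift (i : 'I_d) (x : ell2) : ell2 := Ell2 (shift_fun_summable i x).

Definition shift_word (w : word) : ell2 -> ell2 :=
  foldr (fun i T => shift i \o T) id w.

(* L^(n): the sum of L_w over the words w with exactly n_i letters i *)
Definition shift_sym (n : 'I_d -> nat) : ell2 -> ell2 :=
  \sum_(t : (\sum_(i < d) n i).-tuple 'I_d
        | [forall i, count_mem i t == n i]) shift_word t.

Local Notation adj := (adj ell2_dot).

Definition sym_space : set (ell2 -> ell2) :=
  op_closure ell2_dot (linspan (range shift_sym)).

Definition sym_space0 : set (ell2 -> ell2) :=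
  linspan (shift_sym @` [set n | (1 <= \sum_(i < d) n i)%N]).

Definition op_system : set (ell2 -> ell2) :=
  [set T | exists p q, [/\ sym_space p, sym_space q & T = p + adj q]].

(* A positive linear functional on S + S^*, together with its extension by
   continuity to the norm closure; its values elsewhere are irrelevant. *)
Definition positive_functional (mu : (ell2 -> ell2) -> C R) : Prop :=
  let A := op_closure ell2_dot op_system in
  [/\ forall (a : C R) S T, A S -> A T -> mu (a *: S + T) = a * mu S + mu T,
      forall T, op_system T -> positive_op ell2_dot T -> 0 <= mu T
    & exists M : C R, forall T r, A T -> 0 <= r -> opnorm_le ell2_dot T r ->
        `|mu T| <= M * r].

Definition zLstar (z : 'rV[C R]_d) : ell2 -> ell2 :=
  \sum_(j < d) z 0 j *: adj (shift j).

Definition AC_state (b : 'rV[C R]_d -> C R) (mu : (ell2 -> ell2) -> C R) :=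
  positive_functional mu /\
  forall z, uball z ->
    (1 + b z) / (1 - b z) =
    mu ((id + zLstar z) \o op_inv (id - zLstar z))
      + 'i * 'Im ((1 + b 0) / (1 - b 0)).

(* P^2(mu): a completion of sym_space for <p, q> = mu (q^* p); cls maps an
   element of sym_space to its class. *)
Record P2 (mu : (ell2 -> ell2) -> C R) := MkP2 {
  P2_hilbert :> hilbert R ;
  cls : (ell2 -> ell2) -> P2_hilbert ;
  cls_linear : forall (a : C R) p q, sym_space p -> sym_space q ->
    cls (a *: p + q) = a *: cls p + cls q ;
  cls_dot : forall p q, sym_space p -> sym_space q ->
    hip P2_hilbert (cls p) (cls q) = mu (adj q \o p) ;
  cls_dense : closure (cls @` sym_space) = setT }.

Definition P2_0 mu (P : P2 mu) : set P :=
  closure (linspan (cls P @` sym_space0)).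
Arguments P2_0 {mu} P.

Definition quasi_extreme (b : 'rV[C R]_d -> C R) : Prop :=
  exists mu, AC_state b mu /\ exists P : P2 mu, P2_0 P = setT.

End Ell2.

Section Clark.
Context {R : realType} {d : nat} {b : 'rV[C R]_d -> C R}.
Variable H : rkhs (@b_kernel R d b).
Local Notation dot := (hip H).
Local Notation k0 := (rk H ball0).

Definition contractive_gleason (X : 'I_d -> H -> H) : Prop :=
  [/\ forall j, bounded_op dot (X j),
      forall (f : H) (z : Ball R d),
        ev f z - ev f ball0 = \sum_(j < d) (z : 'rV_d) 0 j * ev (X j f) z
    & exists Xs : 'I_d -> H -> H, (forall j, is_adjoint dot (X j) (Xs j)) /\
        positive_op dot (id - rank1 dot k0 k0 - \sum_(j < d) (Xs j \o X j))].

Definition clark_tuple (alpha : C R) (S : 'I_d -> H -> H) : Prop :=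
  exists (X : 'I_d -> H -> H) (bj : 'I_d -> H),
    [/\ contractive_gleason X,
        forall j (w : Ball R d),
          X j (rk H w) = ((w : 'rV_d) 0 j)^* *: rk H w - (b w)^* *: bj j,
        forall j, bounded_op dot (S j)
      & forall j, is_adjoint dot (S j)
          (X j + (alpha^* * (1 - alpha^* * b 0)^-1) *: rank1 dot (bj j) k0)].

End Clark.

Section Boundary.
Context {R : realType} {d : nat} (b : 'rV[C R]_d -> C R) (zeta : 'rV[C R]_d).

(* The quotient is real-valued; Re only moves it from C R to R. *)
Definition finite_angular_derivative : Prop :=
  (limf_einf (fun z : 'rV[C R]_d =>
     (complex.Re ((1 - `|b z| ^+ 2) / (1 - enorm z ^+ 2)))%:E)
     (within uball (nbhs zeta)) < +oo)%E.

Definition nontangential_region (c : C R) : set 'rV[C R]_d :=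
  [set z | uball z /\ enorm (z - zeta) < c * (1 - enorm z)].

(* b(zeta) = l in the sense of nontangential limits *)
Definition nontangential_limit (l : C R) : Prop :=
  forall c : C R, 1 < c ->
    b @ within (nontangential_region c) (nbhs zeta) --> l.

End Boundary.

(* Main.v *)
Require Import Defs.
From mathcomp Require Import all_boot all_order all_algebra.
From mathcomp Require Import all_classical all_reals all_analysis.
From mathcomp Require Import complex ring lra.
Import Order.TTheory GRing.Theory Num.Theory.
Import numFieldNormedType.Exports.
Local Open Scope classical_set_scope.
Local Open Scope ring_scope.

Set Implicit Arguments.
Unset Strict Implicit.
Unset Printing Implicit Defensive.

(** Write k_w for the reproducing kernel of H(b) at w.  From X_j k_w = w_j^* k_w - b(w)^* b_j and
    <k_w, k_0> = 1 - b(0) b(w)^* one computes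
      S_j^* k_w = w_j^* k_w + (alpha^* - b(w)^* ) / (1 - alpha^* b(0)) b_j.
    Pairing sum_j zeta_j^* S_j h = h with k_w turns the eigenvalue problem into
      (1 - w zeta^* ) h(w) = alpha lambda(h) (1 - b(w) alpha^* ),
      lambda(h) = sum_j zeta_j^* <h, b_j> / (1 - alpha b(0)^* )
    ([clark_eigenP]).  So an eigenvector is a multiple of the function
    k_zeta(w) = (1 - b(w) alpha^* ) / (1 - w zeta^* ), and k_zeta is an
    eigenvector if and only if it belongs to H(b) and lambda(k_zeta) = alpha^*.

    It remains to relate membership of k_zeta in H(b) to the boundary behaviour
    of b, as in the Julia-Caratheodory theorem.

    If k_zeta is in H(b), then Cauchy-Schwarz against k_z bounds
    |1 - b(z) alpha^*| by 2 |k_zeta|^2 |1 - z zeta^*|^2 / (1 - |z|^2)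
    ([boundary_kernel_estimate]); in a nontangential region this is
    O(|1 - z zeta^*|), which gives the nontangential limit alpha, and along the
    radius it bounds (1 - |b|^2) / (1 - |z|^2).

    Conversely, that quotient is |k_z|^2, so a finite angular derivative says
    that k_z stays bounded for z in some set accumulating at zeta.  Along an
    ultrafilter on that set b(z) converges, to a number beta of modulus 1, and
    k_z converges weakly ([weak_limit]); the weak limit is the function k_zeta
    built with beta instead of alpha ([weak_boundary_kernel]).  By the first
    direction beta is then the nontangential limit of b, so beta = alpha.
    Finally, the Gleason property gives sum_j z_j b_j(z) = b(z) - b(0)
    ([gleason_b]), and passing to the limit along the same ultrafilter yields
    sum_j zeta_j <b_j, k_zeta> = alpha - b(0), which is the conjugate form of
    lambda(k_zeta) = alpha^* ([lambda_boundary_kernel]). *)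

(** * Hilbert spaces: Riesz representation and weak limits *)

(** The Pythagorean identity behind both Cauchy-Schwarz and the orthogonality of
    a norm minimizer to the directions along which it is minimal. *)
Lemma dot_sub_proj (K : numClosedFieldType) (U : lmodType K)
    (f : {dot U for @Num.conj K}) (u v : U) : v != 0 ->
  let p := u - (f u v / f v v) *: v in
  f p p = f u u - `|f u v| ^+ 2 / f v v.
Proof.
move=> v0; have fv : 0 < f v v by rewrite dnorm_gt0.
have fvr : (f v v)^* = f v v by apply/conj_Creal/ger0_real/ltW.
rewrite /= dnormB /= dnormZ linearZr_LR /= !rmorphM /= !conjCK !fmorphV /= !fvr.
set a := f u v.
rewrite normrM normfV (gtr0_norm fv) exprMn exprVn normCK.
by field; rewrite ?gt_eqF.
Qed.

Lemma dot_cauchy_schwarz (K : numClosedFieldType) (U : lmodType K)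
    (f : {dot U for @Num.conj K}) (u v : U) :
  `|f u v| ^+ 2 <= f u u * f v v.
Proof.
have [->|v0] := eqVneq v 0; first by rewrite !linear0r normr0 expr0n.
have := dnorm_ge0 f (u - (f u v / f v v) *: v).
by rewrite dot_sub_proj// subr_ge0 ler_pdivrMr// dnorm_gt0.
Qed.

Section Hilbert.
Variables (R : realType) (H : hilbert R).
Implicit Types (x y f g : H).
Local Notation "''[' u , v ]" := (hip H u v) : ring_scope.

Lemma hip_norm_le f g : `|'[f, g]| <= `|f| * `|g|.
Proof.
rewrite -(@ler_pXn2r _ 2) ?nnegrE ?mulr_ge0// exprMn -!hipE.
exact: dot_cauchy_schwarz.
Qed.

Lemma functional_cvg (phi : H -> C R) (M : C R) (F : set_system H) x :
  (forall f g, phi (f - g) = phi f - phi g) ->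
  (forall f, `|phi f| <= M * `|f|) ->
  Filter F -> F --> x -> phi y @[y --> F] --> phi x.
Proof.
move=> phiB phiM FF Fx.
apply/cvgrPdist_lt => e e0.
have e1 : 0 < e / (`|M| + 1) by rewrite divr_gt0 ?ltr_wpDl.
have := @cvgr_dist_lt _ _ _ F FF id x Fx _ e1; apply: filterS => y xy.
rewrite -phiB; apply: le_lt_trans (phiM _) _.
have : `|M * `|x - y| | < e.
  rewrite normrM normr_id.
  apply: (@le_lt_trans _ _ ((`|M| + 1) * `|x - y|)).
    by rewrite ler_wpM2r// lerDl.
  by rewrite mulrC -ltr_pdivlMr ?ltr_wpDl.
apply: le_lt_trans; apply: real_ler_norm.
by apply: ger0_real; apply: le_trans (phiM _).
Qed.

Lemma parallelogram f g :
  '[f - g, f - g] = 2 * '[f, f] + 2 * '[g, g] - '[f + g, f + g].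
Proof. rewrite dnormB dnormD /=; ring. Qed.

Lemma hipBl f g h : '[g - h, f] = '[g, f] - '[h, f].
Proof. by rewrite linearBl. Qed.

(** The representing vector is proportional to the vector of least norm in the
    closed hyperplane phi = 1.  By the parallelogram law almost-minimal vectors of
    the hyperplane are close to each other, so they form a Cauchy filter; its
    limit is orthogonal to the kernel of phi. *)
Theorem riesz_representation (phi : H -> C R) (M : C R) :
  (forall (a : C R) f g, phi (a *: f + g) = a * phi f + phi g) ->
  (forall f, `|phi f| <= M * `|f|) ->
  exists u, forall f, phi f = '[f, u].
Proof.
move=> phi_lin phiM.
have phi0 : phi 0 = 0.
  by have := phi_lin (-1) 0 0; rewrite scaler0 addr0 mulN1r addNr.
have phiZ a f : phi (a *: f) = a * phi f.
  by rewrite -[a *: f]addr0 phi_lin phi0 addr0.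
have phiD f g : phi (f + g) = phi f + phi g.
  by have := phi_lin 1 f g; rewrite scale1r mul1r.
have phiB f g : phi (f - g) = phi f - phi g.
  by rewrite addrC -scaleN1r phi_lin mulN1r addrC.
have [[f0 f0N0]|phi_0] := pselect (exists f, phi f != 0); last first.
  exists 0 => f; rewrite linear0r; apply/eqP; apply: contrapT => /negP fN0.
  by apply: phi_0; exists f.
pose q f : R := complex.Re '[f, f].
have qE f : '[f, f] = (q f)%:C%C.
  by rewrite RRe_real//; apply/ger0_real/dnorm_ge0.
have q0 f : 0 <= q f by rewrite -lecR -qE dnorm_ge0.
pose A := [set f | phi f = 1].
pose f1 := (phi f0)^-1 *: f0.
have Af1 : A f1 by rewrite /A /= /f1 phiZ mulVf.
have infE : has_inf (q @` A).
  by split; [exists (q f1), f1 | exists 0 => _ [f _ <-]].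
pose m := inf (q @` A).
have m_le f : A f -> m <= q f.
  by move=> Af; apply: ge_inf; [case: infE | exists f].
pose B e := [set f | A f /\ q f < m + e].
pose F := filter_from [set e : R | 0 < e] B.
have FF : ProperFilter F.
  apply: filter_from_proper; last first.
    move=> e /= e0; have [_ [f Af <-] qf] := inf_adherent e0 infE.
    by exists f; split.
  apply: filter_from_filter; first by exists 1; rewrite /= ltr01.
  move=> e1 e2 /= e10 e20; exists (Num.min e1 e2); first by rewrite /= lt_min e10.
  move=> f [Af fe]; split; split=> //; apply: lt_le_trans fe _.
    by rewrite lerD2l ge_min lexx.
  by rewrite lerD2l ge_min lexx orbT.
have close e f g : B e f -> B e g -> q (f - g) < 4 * e.
  move=> [Af fe] [Ag ge].
  (* the midpoint is again in the hyperplane, so its square norm is at least m *)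
  have Afg : A (2^-1 *: (f + g)).
    by rewrite /A /= phiZ phiD Af Ag -[1 + 1]/2%:R mulVf// pnatr_eq0.
  have := m_le _ Afg.
  have -> : q (2^-1 *: (f + g)) = q (f + g) / 4.
    apply: complexI; rewrite rmorphM /= -!qE dnormZ normfV normr_nat.
    by rewrite exprVn -natrX fmorphV rmorph_nat /= mulrC.
  have -> : q (f - g) = 2 * q f + 2 * q g - q (f + g).
    apply: complexI; rewrite !(rmorphD, rmorphB, rmorphM, rmorphMn)/= !rmorph1 -!qE.
    rewrite (rmorphN (real_complex R)) /= -qE; exact: parallelogram.
  clear -fe ge; lra.
have cF : cauchy F.
  apply: cauchy_exP => e e0.
  have eE : e = (complex.Re e)%:C%C by rewrite RRe_real ?gtr0_real.
  have r0 : 0 < complex.Re e by rewrite -ltcR -eE.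
  have e'0 : 0 < complex.Re e ^+ 2 / 4 by rewrite divr_gt0 ?exprn_gt0 ?ltr0n.
  have [_ [g Ag <-] qg] := inf_adherent e'0 infE.
  exists g; exists (complex.Re e ^+ 2 / 4) => // f Bf.
  rewrite -ball_normE /=.
  rewrite -(@ltr_pXn2r _ 2) ?nnegrE ?(ltW e0)// -hipE qE eE -rmorphXn ltcR.
  by apply: lt_le_trans (close _ _ _ (conj Ag qg) Bf) _; lra.
have [x Fx] : exists x, F --> x by exists (lim F); exact: (@cauchy_cvg _ F _ cF).
have phi_cvg := functional_cvg phiB phiM _ Fx.
have phix : phi x = 1.
  apply: (@cvg_unique _ (@norm_hausdorff _ _) (phi @ F)); first exact: phi_cvg.
  by apply: cvg_near_cst; exists 1; rewrite /= ?ltr01// => f [].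
have orth g : phi g = 0 -> '[x, g] = 0.
  move=> g0.
  apply: (@cvg_unique _ (@norm_hausdorff _ _) ((fun f => '[f, g]) @ F)).
    apply: (@functional_cvg (fun f => '[f, g]) `|g|) Fx.
      exact: hipBl.
    by move=> f; rewrite mulrC; exact: hip_norm_le.
  have [->|gN0] := eqVneq g 0.
    by apply: cvg_near_cst; apply: nearW => f; rewrite linear0r.
  have qg0 : 0 < q g by rewrite -ltcR -qE dnorm_gt0.
  apply/cvgrPdist_lt => e e0.
  have eE : e = (complex.Re e)%:C%C by rewrite RRe_real ?gtr0_real.
  have r0 : 0 < complex.Re e by rewrite -ltcR -eE.
  exists (complex.Re e ^+ 2 / q g); first by rewrite /= divr_gt0 ?exprn_gt0.
  move=> f [Af fe]; rewrite sub0r normrN.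
  rewrite -(@ltr_pXn2r _ 2) ?nnegrE ?(ltW e0)//.
  (* moving f inside the hyperplane along g can lower its square norm by at
     most e, and the best such move lowers it by |<f, g>|^2 / |g|^2 *)
  pose p := f - ('[f, g] / '[g, g]) *: g.
  have Ap : A p by rewrite /A /= phiB phiZ g0 mulr0 subr0.
  have [t tE] : exists t : R, `|'[f, g]| ^+ 2 = t%:C%C.
    by apply/complex_realP; rewrite ger0_real// exprn_ge0.
  have := m_le _ Ap.
  have -> : q p = q f - t / q g.
    apply: complexI; rewrite rmorphB rmorphM fmorphV /= -!qE -tE.
    exact: dot_sub_proj.
  move=> mle; rewrite tE eE -rmorphXn ltcR.
  have : t / q g < complex.Re e ^+ 2 / q g by clear -fe mle; lra.
  by rewrite ltr_pM2r// invr_gt0.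
have x0 : '[x, x] != 0.
  rewrite dnorm_eq0; apply/eqP => xx; move/eqP: phix.
  by rewrite xx phi0 eq_sym oner_eq0.
exists (('[x, x])^-1 *: x) => f.
have : '[x, f - phi f *: x] = 0 by apply: orth; rewrite phiB phiZ phix mulr1 subrr.
rewrite raddfB /= linearZr_LR /= => /eqP; rewrite subr_eq0 => /eqP xf.
have xxr : ('[x, x])^* = '[x, x] by apply/conj_Creal/ger0_real/dnorm_ge0.
have fx : '[f, x] = phi f * '[x, x].
  by rewrite hermC /= expr0 mul1r xf rmorphM /= conjCK xxr.
by rewrite linearZr_LR /= fmorphV /= xxr fx mulrC mulfK.
Qed.
End Hilbert.

(** The embedding of the reals is an isometry; this lifts real limits to [C R]. *)
Lemma real_complex_cvg (R : realType) (T : Type) (F : set_system T) (f : T -> R)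
    (l : R) : Filter F ->
  f @ F --> l -> (fun t => (f t)%:C%C : C R) @ F --> (l%:C%C : C R).
Proof.
move=> FF fl; apply/cvgrPdist_lt => e e0.
have eE : e = (complex.Re e)%:C%C by rewrite RRe_real ?gtr0_real.
have r0 : 0 < complex.Re e by rewrite -ltcR -eE.
move/cvgrPdist_lt : fl => /(_ _ r0); apply: filterS => t.
rewrite -ltcR -eE; apply: le_lt_trans.
by rewrite -rmorphB normc_def /= expr0n addr0 sqrtr_sqr.
Qed.

Lemma ultra_bounded_cvgR (R : realType) (T : Type) (U : set_system T)
    (f : T -> R) (m : R) : UltraFilter U ->
  (\forall t \near U, `|f t| <= m) -> exists l : R, f @ U --> l.
Proof.
move=> UU fm.
have [|l [_ cl]] := @segment_compact R (- m) m (f @ U) _.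
  by apply: filterS fm => t; rewrite ler_norml /= in_itv.
exists l => V Vl; have [//|nV] := in_ultra_setVsetC (f @^-1` V) UU.
by have [t []] := cl (~` V) V nV Vl.
Qed.

Lemma ultra_bounded_cvg (R : realType) (T : Type) (U : set_system T)
    (f : T -> C R) (M : C R) : UltraFilter U ->
  (\forall t \near U, `|f t| <= M) -> exists l : C R, f @ U --> l.
Proof.
move=> UU fM.
have Re_le t : `|f t| <= M -> `|complex.Re (f t)| <= complex.Re M.
  move=> ftM; have : `|complex.Re (f t)|%:C%C <= M.
    exact: le_trans (normc_ge_Re _) ftM.
  by rewrite lecE => /andP[].
have Im_le t : `|f t| <= M -> `|complex.Im (f t)| <= complex.Re M.
  move=> ftM; have : `|complex.Im (f t)|%:C%C <= M.
    apply: le_trans ftM; rewrite normc_def lecR -sqrtr_sqr ler_wsqrtr//.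
    by rewrite lerDr sqr_ge0.
  by rewrite lecE => /andP[].
have [x fx] : exists x : R, (fun t => complex.Re (f t)) @ U --> x.
  by apply: (@ultra_bounded_cvgR _ _ _ _ (complex.Re M)); apply: filterS fM => t /Re_le.
have [y fy] : exists y : R, (fun t => complex.Im (f t)) @ U --> y.
  by apply: (@ultra_bounded_cvgR _ _ _ _ (complex.Re M)); apply: filterS fM => t /Im_le.
exists (x%:C%C + 'i * y%:C%C).
have -> : f = (fun t => (complex.Re (f t))%:C%C + 'i * (complex.Im (f t))%:C%C).
  by apply/funext => t; rewrite [LHS]complexE complexiE.
apply: cvgD; first exact: real_complex_cvg.
by apply: cvgM; [exact: cvg_cst | exact: real_complex_cvg].
Qed.

Lemma cvg_norm_le (R : realType) (T : Type) (F : set_system T)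
    (f : T -> C R) (l M : C R) : ProperFilter F ->
  f @ F --> l -> (\forall t \near F, `|f t| <= M) -> `|l| <= M.
Proof.
move=> FF fl fM.
have Mr : M \is Num.real.
  by have [t /(le_trans _) tM] := filter_ex fM; rewrite ger0_real ?tM.
rewrite real_leNgt//; apply/negP => Ml.
have e0 : 0 < `|l| - M by rewrite subr_gt0.
move/cvgrPdist_lt : fl => /(_ _ e0) fl.
have [t [tM]] := filter_ex (filterI fM fl).
apply/negP; rewrite -real_leNgt ?realB//.
by apply: le_trans (lerB_dist _ _); rewrite lerB.
Qed.

(** Bounded sets are weakly relatively compact: along an ultrafilter every bounded
    scalar family converges, so f |-> lim <f, v t> exists for all f at once, and
    it is a bounded linear functional. *)
Theorem weak_limit (R : realType) (H : hilbert R) (T : Type) (U : set_system T)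
    (v : T -> H) (M : C R) : UltraFilter U ->
  (\forall t \near U, `|v t| <= M) ->
  exists u, forall f, (fun t => hip H f (v t)) @ U --> hip H f u.
Proof.
move=> UU vM.
have bnd f : \forall t \near U, `|hip H f (v t)| <= `|f| * M.
  apply: filterS vM => t vt; apply: le_trans (hip_norm_le _ _) _.
  by rewrite ler_wpM2l.
have /choice[phi phiE] : forall f, exists l : C R, (fun t => hip H f (v t)) @ U --> l.
  by move=> f; exact: ultra_bounded_cvg (bnd f).
have [u uE] : exists u, forall f, phi f = hip H f u.
  apply: (@riesz_representation _ _ _ M) => [a f g|f].
    apply: (@cvg_unique _ (@norm_hausdorff _ _) _ _ _ _ (phiE (a *: f + g))).
    have -> : (fun t => hip H (a *: f + g) (v t)) =
              (fun t => a * hip H f (v t) + hip H g (v t)).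
      by apply/funext => t; rewrite linearDl linearZl_LR.
    by apply: cvgD => //; apply: cvgM => //; exact: cvg_cst.
  by rewrite mulrC; exact: cvg_norm_le (bnd f).
by exists u => f; rewrite -uE.
Qed.

(** * The unit ball of C^d *)

Section BallGeometry.
Variables (R : realType) (d : nat).
Implicit Types z w : 'rV[C R]_d.

Lemma zdot_dotmx z w : zdot z w = dotmx z w.
Proof. by rewrite /zdot dotmxE mxE; apply: eq_bigr => j _; rewrite !mxE. Qed.

Lemma zdot_ge0 z : 0 <= zdot z z.
Proof. by rewrite zdot_dotmx dnorm_ge0. Qed.

Lemma enorm_sqr z : enorm z ^+ 2 = zdot z z.
Proof. exact: sqrtCK. Qed.

Lemma enorm_ge0 z : 0 <= enorm z.
Proof. by rewrite sqrtC_ge0 zdot_ge0. Qed.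

Lemma zdot_le_enorm z w : `|zdot z w| <= enorm z * enorm w.
Proof.
rewrite -(@ler_pXn2r _ 2) ?nnegrE ?mulr_ge0 ?enorm_ge0// exprMn !enorm_sqr.
by rewrite !zdot_dotmx; exact: dot_cauchy_schwarz.
Qed.

Lemma zdotBl z1 z2 w : zdot (z1 - z2) w = zdot z1 w - zdot z2 w.
Proof. by rewrite !zdot_dotmx linearBl. Qed.

Lemma zdotZl (a : C R) z w : zdot (a *: z) w = a * zdot z w.
Proof. by rewrite !zdot_dotmx linearZl_LR. Qed.

Lemma zdotZr (a : C R) z w : zdot z (a *: w) = a^* * zdot z w.
Proof. by rewrite !zdot_dotmx linearZr_LR. Qed.

Lemma zdotC z w : zdot z w = (zdot w z)^*.
Proof. by rewrite !zdot_dotmx hermC expr0 mul1r. Qed.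

Lemma enormZ (a : C R) z : enorm (a *: z) = `|a| * enorm z.
Proof.
rewrite /enorm zdotZl zdotZr mulrA -normCK sqrtCM ?nnegrE ?zdot_ge0 ?exprn_ge0//.
by rewrite sqrCK.
Qed.

Lemma uballE z : uball z <-> enorm z < 1.
Proof.
by rewrite /uball /= -enorm_sqr -[X in _ < X](expr1n _ 2) ltr_pXn2r ?nnegrE ?enorm_ge0.
Qed.

Lemma conjC_cvg (T : Type) (F : set_system T) (f : T -> C R) (l : C R) :
  Filter F -> f @ F --> l -> (fun t => (f t)^*) @ F --> l^*.
Proof.
move=> FF /cvgrPdist_lt fl; apply/cvgrPdist_lt => e /fl; apply: filterS => t.
by rewrite -rmorphB norm_conjC.
Qed.

Lemma cst_sub_cvg (T : Type) (F : set_system T) (f : T -> C R) (c l : C R) :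
  Filter F -> f @ F --> l -> (fun t => c - f t) @ F --> c - l.
Proof.
move=> FF /cvgrPdist_lt fl; apply/cvgrPdist_lt => e /fl; apply: filterS => t.
by rewrite opprD addrACA subrr add0r opprK addrC distrC.
Qed.

Lemma zdot_cvg (T : Type) (F : set_system T) (f g : T -> 'rV[C R]_d) z w :
  Filter F -> f @ F --> z -> g @ F --> w ->
  (fun t => zdot (f t) (g t)) @ F --> zdot z w.
Proof.
move=> FF fz gw.
have coord (h : T -> 'rV[C R]_d) (v : 'rV[C R]_d) j :
    h @ F --> v -> (fun t => h t 0 j) @ F --> v 0 j.
  move=> hv; apply: (@cvg_comp _ _ _ h (fun M : 'rV_d => M 0 j) F _ _ hv).
  exact: coord_continuous.
apply: (@cvg_big (C R) 'I_d +%R 0 predT _ T F (index_enum _)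
  (fun j t => f t 0 j * (g t 0 j)^*) (fun j => z 0 j * (w 0 j)^*) FF).
  exact: add_continuous.
by move=> j _; apply: cvgM; [exact: coord | apply: conjC_cvg; exact: coord].
Qed.

Lemma enorm1_sub_zdot (zeta z : 'rV[C R]_d) : enorm zeta = 1 ->
  `|1 - zdot z zeta| <= enorm (z - zeta).
Proof.
move=> z1; rewrite -[X in X - _](expr1n _ 2) -z1 enorm_sqr distrC -zdotBl.
by apply: le_trans (zdot_le_enorm _ _) _; rewrite z1 mulr1.
Qed.

Lemma enorm1_zdot_neq1 (zeta z : 'rV[C R]_d) : enorm zeta = 1 -> uball z ->
  1 - zdot z zeta != 0.
Proof.
move=> z1 /uballE zb; rewrite subr_eq0; apply/eqP => e.
have := zdot_le_enorm z zeta; rewrite -e z1 normr1 mulr1 => /le_lt_trans/(_ zb).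
by rewrite ltxx.
Qed.

Lemma ball_sub_zdot_neq0 z w : uball z -> uball w -> 1 - zdot z w != 0.
Proof.
move=> /uballE zb /uballE wb; rewrite subr_eq0; apply/eqP => e.
have := zdot_le_enorm z w; rewrite -e normr1; apply/negP.
rewrite -real_ltNge ?ger0_real ?mulr_ge0 ?enorm_ge0//.
by rewrite mulr_ilt1 ?enorm_ge0.
Qed.

Lemma radial_nbhs (zeta : 'rV[C R]_d) (V : set 'rV[C R]_d) :
  nbhs zeta V -> exists r : C R, [/\ 0 < r, r < 1 & V (r *: zeta)].
Proof.
move=> /nbhs_ballP[e /= e0 eV].
have s0 : 0 < e + `|zeta| + 1 by rewrite ltr_wpDl// addr_ge0// ltW.
exists (1 - e / (e + `|zeta| + 1)); split.
- by rewrite subr_gt0 ltr_pdivrMr// mul1r -addrA ltrDl ltr_wpDl.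
- by rewrite gtrBl divr_gt0.
- apply: eV; rewrite -ball_normE /=.
  rewrite scalerBl scale1r opprB addrC subrK normrZ gtr0_norm ?divr_gt0//.
  rewrite mulrAC ltr_pdivrMr// ltr_pM2l//.
  by rewrite -addrA addrCA ltrDl addr_gt0.
Qed.

End BallGeometry.

(** * Boundary kernels and the boundary behaviour of b *)

Lemma normr1_conjK (K : numClosedFieldType) (a : K) : `|a| = 1 -> a * a^* = 1.
Proof. by move=> a1; rewrite -normCK a1 expr1n. Qed.

Section Kernel.
Variables (R : realType) (d : nat) (b : 'rV[C R]_d -> C R).
Variable H : rkhs (@b_kernel R d b).
Hypothesis b_noncst : exists z w : Ball R d, b z <> b w.
Implicit Types (z w : Ball R d) (f g : H).
Local Notation dot := (hip H).

Lemma evZ a f z : ev (a *: f) z = a * ev f z.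
Proof. by rewrite !ev_rk linearZl_LR. Qed.

Lemma evB f g z : ev (f - g) z = ev f z - ev g z.
Proof. by rewrite !ev_rk linearBl. Qed.

Lemma ball_uball z : uball (z : 'rV_d).
Proof. exact: svalP. Qed.

Lemma ball_defect_gt0 z : 0 < 1 - zdot z z.
Proof. by rewrite subr_gt0; exact: (ball_uball z). Qed.

Lemma rk_norm z : `|rk H z| ^+ 2 = (1 - `|b z| ^+ 2) / (1 - zdot z z).
Proof. by rewrite -hipE -ev_rk rkE /b_kernel -normCK. Qed.

(** A non-constant b satisfies b c = 1 for no scalar c, so
    neither the kernels k_z nor the boundary kernels vanish identically. *)
Lemma kernel_numerator_noncst (c : C R) : exists z, 1 - b z * c != 0.
Proof.
apply: contrapT => /forallNP bc; have {}bc z : b z * c = 1.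
  by apply/eqP; rewrite eq_sym -subr_eq0; apply: contrapT => /negP; exact: bc.
have [z [w zw]] := b_noncst; apply: zw.
have c0 : c != 0.
  by apply/eqP => c0; have := bc z; rewrite c0 mulr0 => /eqP; rewrite eq_sym oner_eq0.
by apply: (mulIf c0); rewrite !bc.
Qed.

(** |k_z|^2 = (1 - |b(z)|^2) / (1 - |z|^2) and k_z is nonzero. *)
Lemma norm_b_lt1 z : `|b z| < 1.
Proof.
have kz : rk H z != 0.
  apply/eqP => k0; have [w] := kernel_numerator_noncst (b z)^*.
  have : ev (rk H z) w = 0 by rewrite k0 ev_rk linear0l.
  rewrite rkE /b_kernel => /eqP; rewrite mulf_eq0 invr_eq0.
  rewrite (negPf (ball_sub_zdot_neq0 (ball_uball w) (ball_uball z))) orbF.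
  by move=> /eqP ->; rewrite eqxx.
rewrite -(@ltr_pXn2r _ 2) ?nnegrE// expr1n -subr_gt0.
have : 0 < `|rk H z| ^+ 2 by rewrite exprn_gt0// normr_gt0.
by rewrite rk_norm pmulr_lgt0// invr_gt0 ball_defect_gt0.
Qed.

Section BoundaryKernel.
Variables (zeta : 'rV[C R]_d) (hzeta : enorm zeta = 1).

(** k is the function k_zeta, with beta for the boundary value b(zeta). *)
Definition boundary_kernel (beta : C R) (k : H) :=
  forall z, ev k z = (1 - b z * beta^*) / (1 - zdot z zeta).

Lemma boundary_kernel_neq0 beta k : boundary_kernel beta k -> k <> 0.
Proof.
move=> hk k0; have [z] := kernel_numerator_noncst beta^*.
have := hk z; rewrite k0 ev_rk linear0l => /esym/eqP.
rewrite mulf_eq0 invr_eq0 (negPf (enorm1_zdot_neq1 hzeta (ball_uball z))) orbF.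
by move=> /eqP ->; rewrite eqxx.
Qed.

Lemma defect_le beta z : `|beta| = 1 ->
  1 - `|b z| ^+ 2 <= 2 * `|1 - b z * beta^*|.
Proof.
move=> b1; have bz := norm_b_lt1 z.
have -> : 1 - `|b z| ^+ 2 = (1 + `|b z|) * (1 - `|b z|) by ring.
apply: ler_pM; first by rewrite addr_ge0.
- by rewrite subr_ge0 ltW.
- by rewrite -[2]/(1 + 1) lerD2l ltW.
apply: le_trans (lerB_dist _ _).
by rewrite normr1 normrM norm_conjC b1 mulr1.
Qed.

(** Cauchy-Schwarz for the evaluation <k, k_z> of k at z gives
    t^2 / s^2 <= |k|^2 (1 - |b(z)|^2) / (1 - |z|^2) with t = |1 - b(z) beta^*| and
    s = |1 - z zeta^*|.  As 1 - |b(z)|^2 <= 2 t, one factor t cancels. *)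
Lemma boundary_kernel_estimate beta k z : `|beta| = 1 -> boundary_kernel beta k ->
  `|1 - b z * beta^*| <= 2 * `|k| ^+ 2 * (`|1 - zdot z zeta| ^+ 2 / (1 - zdot z z)).
Proof.
move=> b1 hk; set t := `|1 - b z * beta^*|; set s := `|1 - zdot z zeta|.
have s0 : 0 < s by rewrite normr_gt0 (enorm1_zdot_neq1 hzeta (ball_uball z)).
have D0 := ball_defect_gt0 z.
have [t0|t0] := eqVneq t 0.
  by rewrite t0 !mulr_ge0// ?exprn_ge0// ?invr_ge0// ltW.
have {}t0 : 0 < t by rewrite lt_def t0 /t normr_ge0.
have bt := defect_le z b1.
have : `|ev k z| ^+ 2 <= `|k| ^+ 2 * `|rk H z| ^+ 2.
  by rewrite ev_rk -exprMn lerXn2r ?nnegrE ?mulr_ge0// hip_norm_le.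
rewrite hk rk_norm normrM normfV -/t -/s => h.
have {}h : (t / s) ^+ 2 <= `|k| ^+ 2 * ((2 * t) / (1 - zdot z z)).
  apply: le_trans h _; rewrite ler_wpM2l ?exprn_ge0//.
  by rewrite ler_wpM2r// invr_ge0 ltW.
rewrite -(ler_pM2l t0).
have -> : t * t = (t / s) ^+ 2 * s ^+ 2 by field; rewrite gt_eqF.
have -> : t * (2 * `|k| ^+ 2 * (s ^+ 2 / (1 - zdot z z))) =
  `|k| ^+ 2 * (2 * t / (1 - zdot z z)) * s ^+ 2 by ring.
by rewrite ler_wpM2r// exprn_ge0// ltW.
Qed.

(** Where |z - zeta| < c (1 - |z|), the estimate above is at most
    2 |k|^2 c |1 - z zeta^*|, since |1 - z zeta^*| <= |z - zeta|. *)
Lemma boundary_kernel_nontangential beta k : `|beta| = 1 ->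
  boundary_kernel beta k -> nontangential_limit b zeta beta.
Proof.
move=> b1 hk c c1; have c0 : 0 < c := lt_trans ltr01 c1.
apply/cvgrPdist_lt => e e0.
have N0 : 0 < 2 * `|k| ^+ 2 * c + 1.
  by rewrite ltr_wpDl// !mulr_ge0 ?exprn_ge0// ltW.
have zz1 : zdot zeta zeta = 1 by rewrite -enorm_sqr hzeta expr1n.
have : (fun x : 'rV[C R]_d => zdot x zeta) @ nbhs zeta --> zdot zeta zeta.
  by apply: zdot_cvg; [exact: cvg_id | exact: cvg_cst].
move/cvgrPdist_lt => /(_ _ (divr_gt0 e0 N0)); rewrite zz1.
apply: filterS => z ze [zb zr].
have -> : `|beta - b z| = `|1 - b z * beta^*|.
  have -> : beta - b z = beta * (1 - b z * beta^*).
    by rewrite mulrBr mulr1 mulrCA normr1_conjK// mulr1.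
  by rewrite normrM b1 mul1r.
apply: le_lt_trans (boundary_kernel_estimate (exist _ z zb) b1 hk) _ => /=.
set s := `|1 - _| in ze *.
have D0 := ball_defect_gt0 (exist _ z zb); rewrite /= in D0.
have z1 : enorm z <= 1 by apply/ltW/uballE.
have sc : s <= c * (1 - zdot z z).
  apply: (le_trans (enorm1_sub_zdot _ hzeta)); apply: le_trans (ltW zr) _.
  by rewrite ler_pM2l// lerD2l lerN2 -enorm_sqr expr2 ler_piMr ?enorm_ge0.
apply: (@le_lt_trans _ _ ((2 * `|k| ^+ 2 * c + 1) * s)).
  rewrite [leRHS]mulrDl mul1r ler_wpDr ?normr_ge0//.
  rewrite -[leRHS]mulrA ler_wpM2l ?mulr_ge0 ?exprn_ge0//.
  by rewrite ler_pdivrMr// expr2 mulrAC ler_wpM2r ?normr_ge0.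
by rewrite mulrC -ltr_pdivlMr.
Qed.

Lemma radial_uball (r : C R) : 0 < r -> r < 1 -> uball (r *: zeta).
Proof. by move=> r0 r1; apply/uballE; rewrite enormZ hzeta mulr1 gtr0_norm. Qed.

(** On the radius z = r zeta one has |1 - z zeta^*| = 1 - r <= 1 - |z|^2, so that
    1 - |b(z)|^2 <= 2 |1 - b(z) beta^*| <= 4 |k|^2 (1 - |z|^2).  Every neighbourhood
    of zeta meets the radius, which bounds the lower limit by 4 |k|^2. *)
Lemma boundary_kernel_angular_derivative beta k : `|beta| = 1 ->
  boundary_kernel beta k -> finite_angular_derivative b zeta.
Proof.
move=> b1 hk; rewrite /finite_angular_derivative limf_einfE.
pose M := 2 * (2 * `|k| ^+ 2).
apply: (@le_lt_trans _ _ (complex.Re M)%:E); last exact: ltry.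
apply: ge_ereal_sup => _ [V FV <-].
have [r [r0 r1 Vr]] := radial_nbhs FV.
have rb := radial_uball r0 r1; have {}Vr := Vr rb.
apply: le_trans (ereal_inf_lbound _) _; first by exists (r *: zeta).
rewrite lee_fin.
suff : (1 - `|b (r *: zeta)| ^+ 2) / (1 - enorm (r *: zeta) ^+ 2) <= M.
  by rewrite lecE => /andP[].
pose z : Ball R d := exist _ _ rb.
rewrite enorm_sqr -[r *: zeta]/(z : 'rV_d).
have D0 := ball_defect_gt0 z.
rewrite ler_pdivrMr//; apply: le_trans (defect_le _ b1) _.
rewrite /M -2!mulrA ler_pM2l// mulrA.
apply: le_trans (boundary_kernel_estimate z b1 hk) _.
rewrite ler_wpM2l ?mulr_ge0 ?exprn_ge0// ler_pdivrMr// -expr2 lerXn2r ?nnegrE ?(ltW D0)//.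
have zz1 : zdot zeta zeta = 1 by rewrite -enorm_sqr hzeta expr1n.
rewrite /= zdotZl zz1 mulr1 zdotZl zdotZr zz1 mulr1.
have -> : `|1 - r| = 1 - r by rewrite ger0_norm// subr_ge0 ltW.
have -> : r^* = r by apply/conj_Creal/ger0_real/ltW.
by rewrite lerD2l lerN2 ler_piMr ?ltW.
Qed.

End BoundaryKernel.
End Kernel.

(** The radius lies in every nontangential region, so the filter of the region of
    aperture 2 is proper and its limits are unique. *)
Lemma nontangential_limit_unique (R : realType) (d : nat) (b : 'rV[C R]_d -> C R)
    (zeta : 'rV[C R]_d) (l l' : C R) : enorm zeta = 1 ->
  nontangential_limit b zeta l -> nontangential_limit b zeta l' -> l = l'.
Proof.
move=> z1 bl bl'.
have c1 : 1 < 2 :> C R by rewrite ltr1n.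
have FF : ProperFilter (within (nontangential_region zeta 2) (nbhs zeta)).
  constructor; last exact: within_filter.
  move=> /radial_nbhs[r [r0 r1]]; apply; split; first exact: radial_uball.
  rewrite -{2}[zeta]scale1r -scalerBl !enormZ z1 !mulr1 distrC !gtr0_norm ?subr_gt0//.
  by rewrite ltr_pMl ?subr_gt0.
apply: (@cvg_unique _ (@norm_hausdorff _ _)
  (b @ within (nontangential_region zeta 2) (nbhs zeta))).
  exact: bl.
exact: bl'.
Qed.

Section JuliaCaratheodory.
Variables (R : realType) (d : nat) (b : 'rV[C R]_d -> C R).
Variable H : rkhs (@b_kernel R d b).
Hypothesis b_noncst : exists z w : Ball R d, b z <> b w.
Implicit Types (z w : Ball R d) (f g : H).
Variables (zeta : 'rV[C R]_d) (hzeta : enorm zeta = 1).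

(** The quotient in the angular derivative is |k_z|^2: a finite lower limit says
    that a fixed bound on |k_z| holds frequently near zeta.  An ultrafilter turns
    this frequent bound into an eventual one. *)
Lemma angular_derivative_ultra : finite_angular_derivative b zeta ->
  exists (U : set_system (Ball R d)) (M : C R),
    [/\ UltraFilter U, (fun z => z : 'rV[C R]_d) @ U --> zeta
      & \forall z \near U, `|rk H z| <= M].
Proof.
rewrite /finite_angular_derivative limf_einfE.
set q := (fun z : 'rV[C R]_d => (complex.Re _)%:E); set l := ereal_sup _ => l_fin.
have [m lm] : exists m : R, (l < m%:E)%E.
  move: l_fin; case: l => [r _|//|_]; last by exists 0; exact: ltNyr.
  by exists (r + 1); rewrite lte_fin ltrDl.
have m_freq V : nbhs zeta V -> exists z, V z /\ `|rk H z| <= sqrtC m%:C%C.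
  move=> Vz; have FV : within uball (nbhs zeta) (V `&` uball).
    by apply: filterS Vz => x Vx xb; split.
  have Vl : (ereal_inf (q @` (V `&` uball)) <= l)%E.
    by apply: ereal_sup_ubound; exists (V `&` uball).
  have /ereal_inf_lt[_ [x [Vx xb] <-]] := le_lt_trans Vl lm.
  rewrite lte_fin => xm; pose z : Ball R d := exist _ x xb.
  exists z; split=> //.
  have zm : `|rk H z| ^+ 2 <= m%:C%C.
    have zr : `|rk H z| ^+ 2 \is Num.real by rewrite ger0_real// exprn_ge0.
    move: zr xm; rewrite rk_norm -enorm_sqr => zr xm.
    by rewrite -(RRe_real zr) lecR ltW.
  rewrite -[leLHS]sqrCK// ler_sqrtC// nnegrE ?exprn_ge0//.
  by apply: le_trans zm; rewrite exprn_ge0.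
pose B (V : set 'rV[C R]_d) :=
  [set z : Ball R d | V (ballv z) /\ `|rk H z| <= sqrtC m%:C%C].
have FF : ProperFilter (filter_from (nbhs zeta) B).
  apply: filter_from_proper => [|V /m_freq[z zV]]; last by exists z.
  apply: filter_from_filter; first by exists setT; exact: filterT.
  move=> V W Vz Wz; exists (V `&` W); first exact: filterI.
  by move=> z [[zV zW] zm]; split; split.
have [U [UU FU]] := ultraFilterLemma FF.
exists U, (sqrtC m%:C%C); split=> //.
  by move=> V Vz; apply: FU; exists V => // z [].
by apply: FU; exists setT => [|z []//]; exact: filterT.
Qed.

(** |beta| = 1 because 1 - |b(z)|^2 = |k_z|^2 (1 - |z|^2) tends to 0, and the value
    at w of the weak limit k is the conjugate of
    lim <k_w, k_z> = lim k_w(z) = (1 - beta b(w)^* ) / (1 - zeta w^* ). *)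
Lemma weak_boundary_kernel (U : set_system (Ball R d)) (M : C R) :
  UltraFilter U -> (fun z => z : 'rV[C R]_d) @ U --> zeta ->
  (\forall z \near U, `|rk H z| <= M) ->
  exists beta k, [/\ `|beta| = 1, boundary_kernel zeta beta k,
    (fun z => b z) @ U --> beta & forall f, (ev f) @ U --> hip H f k].
Proof.
move=> UU Uz UM.
have [beta bU] : exists beta : C R, (fun z => b z) @ U --> beta.
  apply: (@ultra_bounded_cvg _ _ _ _ 1); apply: nearW => z.
  exact/ltW/(norm_b_lt1 H).
have [k kU] := weak_limit UU UM.
have evU f : (ev f) @ U --> hip H f k.
  have -> : ev f = (fun z => hip H f (rk H z)) by apply/funext => z; rewrite ev_rk.
  exact: kU.
have zz1 : zdot zeta zeta = 1 by rewrite -enorm_sqr hzeta expr1n.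
exists beta, k; split=> //.
- have bb : (fun z => `|b z| * `|b z|) @ U --> `|beta| * `|beta|.
    by apply: cvgM; exact: cvg_norm.
  have b1 : (fun z => `|b z| * `|b z|) @ U --> (1 : C R).
    apply/cvgrPdist_lt => e e0.
    have : (fun z => zdot z z) @ U --> zdot zeta zeta by apply: zdot_cvg.
    have N0 : 0 < M ^+ 2 + 1.
      have [z zM] := filter_ex UM.
      by rewrite ltr_wpDl// exprn_ge0//; apply: le_trans zM.
    move/cvgrPdist_lt => /(_ _ (divr_gt0 e0 N0)); rewrite zz1.
    apply: filterS2 UM => z zM; rewrite -expr2.
    have D0 := ball_defect_gt0 z.
    have -> : 1 - `|b z| ^+ 2 = `|rk H z| ^+ 2 * (1 - zdot z z).
      by rewrite rk_norm divfK// gt_eqF.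
    rewrite normrM (ger0_norm (exprn_ge0 _ (normr_ge0 _))) ltr_pdivlMr// mulrC.
    apply: le_lt_trans; rewrite ler_wpM2r//.
    apply: (@le_trans _ _ (M ^+ 2)); last by rewrite lerDl.
    by rewrite lerXn2r ?nnegrE//; apply: le_trans zM.
  have /eqP : `|beta| * `|beta| = 1.
    exact: (@cvg_unique _ (@norm_hausdorff _ _) _ _ _ _ bb b1).
  by rewrite -expr2 sqrp_eq1// => /eqP.
move=> w.
have kw : hip H (rk H w) k = (1 - beta * (b w)^*) / (1 - zdot zeta w).
  apply: (@cvg_unique _ (@norm_hausdorff _ _) _ _ _ _ (evU (rk H w))).
  have -> : ev (rk H w) = (fun z => (1 - b z * (b w)^*) / (1 - zdot z w)).
    by apply/funext => z; rewrite rkE.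
  apply: cvgM.
    apply: cst_sub_cvg.
    by apply: cvgM; [exact: bU | exact: cvg_cst].
  apply: (@cvgV _ _ _ _ (fun z => 1 - zdot z w)).
    rewrite -conjC_eq0 rmorphB rmorph1 /= -zdotC.
    exact: enorm1_zdot_neq1 hzeta (ball_uball w).
  apply: cst_sub_cvg.
  by apply: zdot_cvg; [exact: Uz | exact: cvg_cst].
rewrite ev_rk hermC expr0 mul1r /= kw rmorphM fmorphV /= !rmorphB !rmorph1 rmorphM /=.
by rewrite conjCK -zdotC mulrC [b w * _]mulrC mulrC.
Qed.

End JuliaCaratheodory.

(** * The eigenvalue problem of the Clark tuple *)

Section Clark.
Variables (R : realType) (d : nat) (b : 'rV[C R]_d -> C R).
Variable H : rkhs (@b_kernel R d b).
Hypothesis b_noncst : exists z w : Ball R d, b z <> b w.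
Implicit Types (z w : Ball R d) (f g h : H).
Local Notation dot := (hip H).
Local Notation b0 := (b 0).

(** The Gleason property of k_w reads b(w)^* (sum_j z_j b_j(z)) =
    b(w)^* (b(z) - b(0)); non-constancy provides a w with b(w) nonzero. *)
Lemma gleason_b (X : 'I_d -> H -> H) (bj : 'I_d -> H) z :
  contractive_gleason X ->
  (forall j w, X j (rk H w) = ((w : 'rV_d) 0 j)^* *: rk H w - (b w)^* *: bj j) ->
  \sum_(j < d) (z : 'rV_d) 0 j * ev (bj j) z = b z - b0.
Proof.
move=> [_ gleason _] Xk.
have [w bw] : exists w, b w != 0.
  apply: contrapT => /forallNP b0'; have [u [v]] := b_noncst; apply.
  have bz (t : Ball R d) : b t = 0 by apply/eqP; apply: contrapT => /negP; exact: b0'.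
  by rewrite !bz.
have D : 1 - zdot z w != 0 := ball_sub_zdot_neq0 (ball_uball z) (ball_uball w).
have := gleason (rk H w) z.
have -> : \sum_(j < d) (z : 'rV_d) 0 j * ev (X j (rk H w)) z =
    zdot z w * ev (rk H w) z - (b w)^* * \sum_(j < d) (z : 'rV_d) 0 j * ev (bj j) z.
  rewrite mulr_suml mulr_sumr -sumrB; apply: eq_bigr => j _.
  by rewrite Xk evB !evZ; ring.
set s := \sum_(j < d) _; rewrite !rkE /b_kernel /=.
have -> : zdot (0 : 'rV[C R]_d) w = 0 by rewrite zdot_dotmx linear0l.
rewrite subr0 divr1 => e.
apply: (mulfI (_ : (b w)^* != 0)); first by rewrite conjC_eq0.
have -> : (b w)^* * s = zdot z w * ((1 - b z * (b w)^*) / (1 - zdot z w)) -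
  ((1 - b z * (b w)^*) / (1 - zdot z w) - (1 - b0 * (b w)^*)) by rewrite e; ring.
by field.
Qed.

Variables (alpha : C R) (halpha : `|alpha| = 1).

Lemma one_sub_b0_neq0 : 1 - alpha^* * b0 != 0.
Proof.
rewrite subr_eq0; apply/eqP => e.
have : `|b0| < 1 := norm_b_lt1 H b_noncst Defs.ball0.
have -> : `|b0| = `|alpha^* * b0| by rewrite normrM norm_conjC halpha mul1r.
by rewrite -e normr1 ltxx.
Qed.

Variables (X : 'I_d -> H -> H) (bj : 'I_d -> H) (S : 'I_d -> H -> H).
Hypothesis Xk : forall j w,
  X j (rk H w) = ((w : 'rV_d) 0 j)^* *: rk H w - (b w)^* *: bj j.
Hypothesis S_adj : forall j, is_adjoint dot (S j)
  (X j + (alpha^* * (1 - alpha^* * b0)^-1) *: rank1 dot (bj j) (rk H Defs.ball0)).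

(** S_j h paired with k_w, through the formula for S_j^* k_w in which the
    terms in b(0) b(w)^* cancel. *)
Lemma ev_clark j h w : ev (S j h) w =
  (w : 'rV_d) 0 j * ev h w + (alpha - b w) / (1 - alpha * b0^*) * dot h (bj j).
Proof.
have D := one_sub_b0_neq0.
rewrite ev_rk S_adj; set c := alpha^* * _.
have -> : (X j + c *: rank1 dot (bj j) (rk H Defs.ball0)) (rk H w) =
  X j (rk H w) + c *: (dot (rk H w) (rk H Defs.ball0) *: bj j) by [].
rewrite Xk -ev_rk rkE /b_kernel /= {}/c.
have -> : zdot (0 : 'rV[C R]_d) w = 0 by rewrite zdot_dotmx linear0l.
rewrite subr0 divr1 scalerA.
have -> : ((w : 'rV_d) 0 j)^* *: rk H w - (b w)^* *: bj j +
   alpha^* * (1 - alpha^* * b0)^-1 * (1 - b0 * (b w)^*) *: bj j =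
   ((w : 'rV_d) 0 j)^* *: rk H w + ((alpha^* - (b w)^*) / (1 - alpha^* * b0)) *: bj j.
  rewrite -addrA -scaleNr -scalerDl; congr (_ + _ *: _).
  by field.
have hipZr c f g : dot f (c *: g) = c^* * dot f g by rewrite linearZr_LR.
rewrite raddfD /= !hipZr conjCK -ev_rk; congr (_ + _ * _).
by rewrite rmorphM fmorphV /= !rmorphB rmorph1 rmorphM /= !conjCK.
Qed.

Variables (zeta : 'rV[C R]_d) (hzeta : enorm zeta = 1).
Local Notation lambda h :=
  ((1 - alpha * b0^*)^-1 * \sum_(j < d) (zeta 0 j)^* * dot h (bj j)).

Lemma clark_eigenP h : \sum_(j < d) (zeta 0 j)^* *: S j h = h <->
  forall w, ev h w = (alpha * lambda h) * ((1 - b w * alpha^*) / (1 - zdot w zeta)).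
Proof.
have evS w : ev (\sum_(j < d) (zeta 0 j)^* *: S j h) w =
    zdot w zeta * ev h w + (alpha - b w) * lambda h.
  rewrite ev_rk linear_sumlz /=.
  rewrite mulr_suml !mulr_sumr -big_split /=; apply: eq_bigr => j _.
  by rewrite -ev_rk evZ ev_clark; ring.
have alphaE w : alpha - b w = alpha * (1 - b w * alpha^*).
  by rewrite mulrBr mulr1 mulrCA normr1_conjK// mulr1.
set l := lambda h in evS *.
split=> [e w|e].
  have D := enorm1_zdot_neq1 hzeta (ball_uball w).
  have := evS w; rewrite e alphaE => ew.
  apply: (mulIf D); rewrite mulrA divfK//.
  by rewrite mulrBr mulr1 {1}ew; ring.
apply: ev_inj; apply/funext => w; rewrite evS e alphaE.
have D := enorm1_zdot_neq1 hzeta (ball_uball w).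
by field.
Qed.

Lemma clark_eigen_boundary_kernel h :
  \sum_(j < d) (zeta 0 j)^* *: S j h = h -> h <> 0 ->
  exists c, boundary_kernel zeta alpha (c *: h).
Proof.
move=> /clark_eigenP hE h0; set c := alpha * _ in hE.
have c0 : c != 0.
  apply/eqP => c0; apply: h0; apply: ev_inj; apply/funext => w.
  by rewrite hE c0 mul0r ev_rk linear0l.
by exists c^-1 => w; rewrite evZ hE mulrA mulVf// mul1r.
Qed.

(** When lambda(k) = alpha^*, the factor alpha lambda(c k) of [clark_eigenP] is c. *)
Lemma boundary_kernel_eigenP k : boundary_kernel zeta alpha k -> lambda k = alpha^* ->
  forall h, \sum_(j < d) (zeta 0 j)^* *: S j h = h <-> exists c, h = c *: k.
Proof.
move=> kE lk h; split=> [/clark_eigenP hE|[c ->]].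
  exists (alpha * lambda h); apply: ev_inj; apply/funext => w.
  by rewrite hE evZ kE.
apply/clark_eigenP => w; rewrite evZ kE; congr (_ * _).
have -> : \sum_(j < d) (zeta 0 j)^* * dot (c *: k) (bj j) =
    c * \sum_(j < d) (zeta 0 j)^* * dot k (bj j).
  by rewrite mulr_sumr; apply: eq_bigr => j _; rewrite linearZl_LR /=; ring.
by rewrite [_^-1 * (c * _)]mulrCA lk mulrCA normr1_conjK ?mulr1.
Qed.

Hypothesis gleason_X : contractive_gleason X.

(** The limit of sum_j z_j b_j(z) = b(z) - b(0) along U is
    sum_j zeta_j <b_j, k> = alpha - b(0); conjugating and using
    alpha^* (1 - alpha b(0)^* ) = alpha^* - b(0)^* gives the claim. *)
Lemma lambda_boundary_kernel (U : set_system (Ball R d)) k :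
  ProperFilter U -> (fun z => z : 'rV[C R]_d) @ U --> zeta ->
  (fun z => b z) @ U --> alpha -> (forall f, ev f @ U --> dot f k) ->
  lambda k = alpha^*.
Proof.
move=> UU Uz Ub Uk.
have sumE : \sum_(j < d) zeta 0 j * dot (bj j) k = alpha - b0.
  apply: (@cvg_unique _ (@norm_hausdorff _ _)
    ((fun z => \sum_(j < d) (z : 'rV_d) 0 j * ev (bj j) z) @ U)).
    apply: (@cvg_big (C R) 'I_d +%R 0 predT _ _ U (index_enum _)
      (fun j z => (z : 'rV_d) 0 j * ev (bj j) z) (fun j => zeta 0 j * dot (bj j) k) _).
      exact: add_continuous.
    move=> j _; apply: cvgM; last exact: Uk.
    apply: (@cvg_comp _ _ _ (fun z : Ball R d => z : 'rV_d) (fun M : 'rV_d => M 0 j) U _ _ Uz).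
    exact: coord_continuous.
  have -> : (fun z => \sum_(j < d) (z : 'rV_d) 0 j * ev (bj j) z) = (fun z => b z - b0).
    by apply/funext => z; exact: (gleason_b z gleason_X Xk).
  by apply: cvgD; [exact: Ub | exact: cvg_cst].
have -> : \sum_(j < d) (zeta 0 j)^* * dot k (bj j) = (alpha - b0)^*.
  rewrite -sumE rmorph_sum; apply: eq_bigr => j _.
  by rewrite rmorphM /= [dot k _]hermC expr0 mul1r.
have D : 1 - alpha * b0^* != 0.
  by rewrite -conjC_eq0 rmorphB rmorph1 rmorphM /= conjCK one_sub_b0_neq0.
apply: (mulfI D); rewrite mulrA mulfV// mul1r rmorphB mulrBl mul1r.
by rewrite mulrAC normr1_conjK// mul1r.
Qed.

End Clark.

Theorem theorem6p2 (R : realType) (d : nat) (hd : (0 < d)%N)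
    (b : 'rV[C R]_d -> C R)
    (H2 : rkhs (@szego_kernel R d)) (Hb : rkhs (@b_kernel R d b))
    (hb : contractive_multiplier H2 b)
    (hnc : exists z w : Ball R d, b z <> b w)
    (hqe : quasi_extreme b)
    (alpha : C R) (halpha : `|alpha| = 1)
    (S : 'I_d -> Hb -> Hb) (hS : clark_tuple alpha S)
    (zeta : 'rV[C R]_d) (hzeta : enorm zeta = 1) :
  ((exists h : Hb, h <> 0 /\ \sum_(j < d) (zeta 0 j)^* *: S j h = h) <->
   (finite_angular_derivative b zeta /\ nontangential_limit b zeta alpha)) /\
  (finite_angular_derivative b zeta /\ nontangential_limit b zeta alpha ->
   exists kzeta : Hb,
     [/\ forall z : Ball R d,
           ev kzeta z = (1 - b z * alpha^*) / (1 - zdot z zeta),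
         kzeta <> 0
       & forall h : Hb, \sum_(j < d) (zeta 0 j)^* *: S j h = h <->
           exists c : C R, h = c *: kzeta]).
Proof.
have [X [bj [gleason_X Xk _ S_adj]]] := hS.
have kernel : finite_angular_derivative b zeta /\ nontangential_limit b zeta alpha ->
  exists k : Hb, [/\ boundary_kernel zeta alpha k, k <> 0
    & forall h : Hb, \sum_(j < d) (zeta 0 j)^* *: S j h = h <->
           exists c : C R, h = c *: k].
  move=> [fin lim_alpha].
  have [U [M [UU Uz UM]]] := angular_derivative_ultra Hb fin.
  have [beta [k [b1 kE Ub Uk]]] := weak_boundary_kernel hnc hzeta UU Uz UM.
  have ba : beta = alpha.
    apply: nontangential_limit_unique lim_alpha => //.
    exact: boundary_kernel_nontangential kE.
  rewrite ba in kE Ub; exists k; split=> //.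
    exact: boundary_kernel_neq0 kE.
  apply: (boundary_kernel_eigenP hnc halpha Xk S_adj hzeta kE).
  exact: (lambda_boundary_kernel hnc halpha Xk gleason_X _ Uz Ub Uk).
split; last exact: kernel.
split=> [[h [h0 hE]]|/kernel[k [kE k0 kP]]]; last first.
  by exists k; split=> //; apply/kP; exists 1; rewrite scale1r.
have [c ck] := clark_eigen_boundary_kernel hnc halpha Xk S_adj hzeta hE h0.
split; first exact: boundary_kernel_angular_derivative ck.
exact: boundary_kernel_nontangential ck.
Qed.
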